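(* Let $A\sim\mathcal{N}(0,1)^{n\times n}$. Let $\varepsilon\ge0$, $\delta\in[0,1]$, and let $g:\mathbb{R}^{n\times n}\to\mathbb{R}$ be a (Borel measurable) function such that $$\big||\mathrm{Per}(A)|^2-g(A)\big|\le\varepsilon$$ holds with probability $1-\delta$. Let $B\in\mathbb{R}^{n\times n}$ be an arbitrary matrix with entries $|b_{ij}|\le1$ and let $t\in\mathbb{R}$. Then $$\big||\mathrm{Per}(A+tB)|^2-g(A+tB)\big|\le\varepsilon$$ holds with probability at least $1-\sqrt{e^{\|tB\|^2}\cdot\delta}$, where $\|\cdot\|$ is the Hilbert–Schmidt norm.
   Context: $\mathcal{N}(0,1)^{n\times n}$ is the distribution of $n\times n$ matrices with i.i.d. real standard normal entries; $\mathrm{Per}$ is the matrix permanent; the Hilbert–Schmidt norm is $\|M\|^2=\sum_{i,j}|m_{ij}|^2$. *)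

(* Defs.v *)
From HB Require Import structures.
From mathcomp Require Import all_boot all_order all_algebra all_fingroup.
From mathcomp Require Import all_classical all_reals all_analysis.
Import Order.TTheory GRing.Theory Num.Theory numFieldNormedType.Exports.

Set Implicit Arguments.
Unset Strict Implicit.
Unset Printing Implicit Defensive.

Local Open Scope classical_set_scope.
Local Open Scope ring_scope.

Definition permanent (R : comNzRingType) (n : nat) (M : 'M[R]_n) : R :=
  \sum_(s : 'S_n) \prod_(i < n) M i (s i).

Definition hs_norm (R : realType) (m n : nat) (M : 'M[R]_(m, n)) : R :=
  Num.sqrt (\sum_(i < m) \sum_(j < n) `|M i j| ^+ 2).

(* 'M[R]_(m, n) with the sigma-algebra generated by the open sets of its
   canonical topology (the topology of R^(m * n)) *)
Definition borel_matrix (R : realType) (m n : nat) :=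
  g_sigma_algebraType (@open 'M[R]_(m, n)).

Definition mutually_independent (d : measure_display) (T : measurableType d)
    (R : realType) (P : probability T R) (I : finType) (X : I -> T -> R) :=
  forall (J : {set I}) (V : I -> set R), (forall i, measurable (V i)) ->
    P (\bigcap_(i in [set` J]) (X i @^-1` V i)) =
    (\prod_(i in J) P (X i @^-1` V i))%E.

Definition std_gaussian_matrix (d : measure_display) (T : measurableType d)
    (R : realType) (P : probability T R) (m n : nat) (A : T -> 'M[R]_(m, n)) :=
  [/\ forall i j, measurable_fun [set: T] (fun w => A w i j),
      forall i j (V : set R), measurable V ->
        P ((fun w => A w i j) @^-1` V) = normal_prob 0 1 V &
      mutually_independent P (fun (k : 'I_m * 'I_n) w => A w k.1 k.2)].

(* Main.v *)
(* Write w_C(M) = prod_ij exp(c_ij m_ij - c_ij^2 / 2) for the likelihood ratio of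
   N(C,1) against N(0,1). By the Cameron-Martin formula,
   P(A + C in S) = E[1_S(A) w_C(A)], which Cauchy-Schwarz bounds by
   (P(A in S) E[w_C(A)^2])^(1/2), and E[w_C(A)^2] = exp(||C||^2). The theorem is the
   case C = tB, with S the Borel set of matrices where the approximation fails.

   Two finite Borel measures on matrices that agree on boxes are equal, so the
   Cameron-Martin formula reduces to boxes, where independence of the entries
   factors it into the one-dimensional identity
   E[1_V(X) exp(c X - c^2/2)] = P(X + c in V). *)

Require Import Defs.
From HB Require Import structures.
From mathcomp Require Import all_boot all_order all_algebra.
From mathcomp Require Import all_classical all_reals all_analysis.
From mathcomp Require Import measurable_realfun ring.
Import Order.TTheory GRing.Theory Num.Theory numFieldNormedType.Exports.

Set Implicit Arguments.
Unset Strict Implicit.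
Unset Printing Implicit Defensive.
Local Open Scope classical_set_scope.
Local Open Scope ring_scope.

Import HBNNSimple.

(** * Measures given by a density, and integration against them *)

Section density.
Local Open Scope ereal_scope.
Context (d : measure_display) (T : measurableType d) (R : realType).
Variables (mu : {measure set T -> \bar R}) (F : T -> R).
Hypotheses (mF : measurable_fun [set: T] F) (F0 : forall x, (0 <= F x)%R).

Let mEF (D : set T) : measurable_fun D (fun x => (F x)%:E).
Proof. exact/measurable_funTS/measurable_EFinP. Qed.

(** Monotone convergence along simple functions increasing to [h] reduces to simple functions, and
    linearity to indicators, for which the identity is the hypothesis on [nu]. *)
Lemma ge0_integral_density (nu : {measure set T -> \bar R}) (h : T -> \bar R) :
  (forall V, measurable V -> nu V = \int[mu]_(x in V) (F x)%:E) ->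
  measurable_fun [set: T] h -> (forall x, 0 <= h x) ->
  \int[nu]_x h x = \int[mu]_x (h x * (F x)%:E).
Proof.
move=> nuE mh h0; pose g := nnsfun_approx measurableT mh.
have gh x : EFin (g n x) @[n --> \oo] --> h x by apply: cvg_nnsfun_approx.
have mg n : measurable_fun [set: T] (fun x => (g n x)%:E).
  exact/measurable_EFinP/measurable_funP.
have g0 n x : 0 <= (g n x)%:E by rewrite lee_fin.
have ndg x : {homo (fun n => (g n x)%:E) : a b / (a <= b)%N >-> a <= b}.
  by move=> a b ab; rewrite lee_fin; exact/lefP/nd_nnsfun_approx.
have -> : \int[nu]_x h x = limn (fun n => \int[nu]_x (g n x)%:E).
  rewrite -monotone_convergence//.
  by apply: eq_integral => x _; apply/esym/cvg_lim.
have -> : \int[mu]_x (h x * (F x)%:E) =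
    limn (fun n => \int[mu]_x ((g n x)%:E * (F x)%:E)).
  rewrite -monotone_convergence//.
  - apply: eq_integral => x _; apply/esym/cvg_lim => //.
    exact: cvgeZr.
  - by move=> n; apply: emeasurable_funM.
  - by move=> n x _; rewrite mule_ge0// lee_fin.
  - by move=> x _ a b ab; rewrite lee_wpmul2r ?lee_fin//; exact: ndg.
congr (limn _); apply/funext => n.
have gE x : (g n x)%:E = \sum_(y \in range (g n)) (y * \1_(g n @^-1` [set y]) x)%:E.
  by rewrite fsumEFin// [in LHS](fimfunE (g n)).
under eq_integral do rewrite gE.
under [RHS]eq_integral => x _.
  rewrite gE ge0_mule_fsuml; last by move=> y; exact: nnfun_muleindic_ge0.
  over.
have mi r : measurable_fun [set: T] (fun x => (r * \1_(g n @^-1` [set r]) x)%:E).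
  by apply/measurable_EFinP; apply: measurable_funM.
rewrite !ge0_integral_fsum//; last 3 first.
- by move=> r; apply: emeasurable_funM.
- by move=> r x _; rewrite mule_ge0// ?lee_fin//; exact: nnfun_muleindic_ge0.
- by move=> r x _; exact: nnfun_muleindic_ge0.
(* Only attained values [g n z] enter the sum; they are nonnegative, so the factor can be pulled out
   of the integral. *)
apply: eq_fsbigr => r; rewrite inE => -[z _ <-].
rewrite integralZl_indic_nnsfun// integral_indic//= setIT nuE//.
under [RHS]eq_integral do rewrite EFinM -muleA.
rewrite ge0_integralZl//=.
- congr (_ * _); rewrite integral_mkcond; apply: eq_integral => x _.
  by rewrite epatch_indic muleC.
- by apply: emeasurable_funM => //; apply/measurable_EFinP.
- by move=> x _; rewrite mule_ge0 ?lee_fin.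
Qed.

(** The two anonymous arguments record the measurability and nonnegativity proofs in the term, so
    that the measure structure declared below can be attached to [density mF F0]. *)
Definition density (_ : measurable_fun [set: T] F) (_ : forall x, (0 <= F x)%R)
  (V : set T) : \bar R := \int[mu]_(x in V) (F x)%:E.

Let density0 : density mF F0 set0 = 0.
Proof. exact: integral_set0. Qed.

Let density_ge0 V : 0 <= density mF F0 V.
Proof. by apply: integral_ge0 => x _; rewrite lee_fin. Qed.

Let density_sigma_additive : semi_sigma_additive (density mF F0).
Proof.
move=> V mV tV mUV; rewrite /density ge0_integral_bigcup//; last first.
  by move=> x _; rewrite lee_fin.
apply: is_cvg_ereal_nneg_natsum_cond => n _ _.
exact: density_ge0.
Qed.

HB.instance Definition _ := isMeasure.Build _ _ _
  (density mF F0) density0 density_ge0 density_sigma_additive.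

End density.

(** * Translation and exponential tilting of the one-dimensional Gaussian *)

Section gaussian_shift.
Context (R : realType).
Local Notation mu := (@lebesgue_measure R).
Local Open Scope ereal_scope.

(** By uniqueness of Lebesgue measure it suffices to compare on half-open intervals, whose length a
    translation preserves. *)
Lemma lebesgue_measure_translation (c : R) (V : set R) : measurable V ->
  mu ((fun x => x + c)%R @^-1` V) = mu V.
Proof.
move=> mV.
have mf : measurable_fun [set: R] (+%R^~ c : R -> measurableTypeR R).
  exact: measurable_funD.
change (pushforward mu (+%R^~ c : R -> measurableTypeR R) V = mu V).
apply/esym/lebesgue_measure_unique => //= _ [[a b]] _ <-.
rewrite /pushforward/= (_ : _ @^-1` _ = [set` `](a - c)%R, (b - c)%R]]); last first.
  by apply/seteqP; split => x /=; rewrite !in_itv/= ltrBlDr lerBrDr.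
rewrite !lebesgue_measure_itv/= !lte_fin ltrD2r.
by case: ifPn => // _; rewrite -!EFinB; congr EFin; ring.
Qed.

(** The density centred at [c], evaluated at [x + c], is the standard density at [x], and Lebesgue
    measure is invariant under this substitution. *)
Lemma normal_prob_translation (c : R) (V : set R) : measurable V ->
  normal_prob 0 1 ((fun x => x + c)%R @^-1` V) = normal_prob c 1 V.
Proof.
move=> mV; rewrite /normal_prob.
pose f : R -> measurableTypeR R := +%R^~ c.
have mf : measurable_fun [set: R] f by exact: measurable_funD.
have mpdf : measurable_fun V (fun x => (normal_pdf c 1 x)%:E).
  by apply/measurable_EFinP/measurable_funTS; exact: measurable_normal_pdf.
transitivity (\int[mu]_(x in f @^-1` V) ((fun x => (normal_pdf c 1 x)%:E) \o f) x).
  by apply: eq_integral => x _; rewrite /= /f !normal_pdfE// /normal_fun addrK subr0.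
rewrite -ge0_integral_pushforward//; last first.
  by move=> x _; rewrite lee_fin normal_pdf_ge0.
apply: eq_measure_integral => A mA _.
exact: lebesgue_measure_translation.
Qed.

(** Completing the square, [c x - c^2/2 - x^2/2 = - (x - c)^2/2]: the exponential factor turns the
    density of N(0,1) into that of N(c,1). *)
Lemma integral_normal_tilt (c : R) (V : set R) : measurable V ->
  \int[normal_prob 0 1]_x (\1_V x * expR (c * x - c ^+ 2 / 2))%:E =
  normal_prob 0 1 ((fun x => x + c)%R @^-1` V).
Proof.
move=> mV; rewrite normal_prob_translation//.
have mtilt : measurable_fun [set: R]
    (fun x => (\1_V x * expR (c * x - c ^+ 2 / 2))%:E).
  apply/measurable_EFinP/measurable_funM; first exact: measurable_indic.
  by apply: measurableT_comp => //; exact: measurable_funB.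
rewrite (ge0_integral_density (measurable_normal_pdf 0 1)
  (@normal_pdf_ge0 _ 0 1) (mu := mu))//.
rewrite /normal_prob [RHS]integral_mkcond; apply: eq_integral => x _.
rewrite epatch_indic -!EFinM; congr EFin.
rewrite !normal_pdfE// [RHS]mulrC -mulrA; congr (_ * _)%R.
rewrite mulrCA; congr (_ * _)%R.
by rewrite /normal_fun -expRD; congr expR; field.
Qed.

End gaussian_shift.

(** * Expectations of products of independent variables *)

Section independence.
Local Open Scope ereal_scope.
Context (d : measure_display) (T : measurableType d) (R : realType).
Variables (P : probability T R) (I : finType) (X : I -> T -> R).
Hypotheses (mX : forall i, measurable_fun [set: T] (X i))
  (indepX : mutually_independent P X).

(** A product of indicators is the indicator of an intersection, so independence applies with [J]
    the full index set. *)
Lemma expectation_prod_indic (V : I -> set R) : (forall i, measurable (V i)) ->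
  \int[P]_w (\prod_i \1_(V i) (X i w))%:E = \prod_i \int[P]_w (\1_(V i) (X i w))%:E.
Proof.
move=> mV.
have mXV i : measurable (X i @^-1` V i) by rewrite -[X in measurable X]setTI; exact: mX.
transitivity (P (\bigcap_(i in [set` [set: I]%SET]) (X i @^-1` V i))).
  rewrite -[X in P X]setIT -integral_indic//; last first.
    by apply: fin_bigcap_measurable => //; exact: finite_finset.
  apply: eq_integral => w _; congr EFin.
  have [/= Vw|/= nVw] := pselect ((\bigcap_(i in [set` [set: I]%SET]) (X i @^-1` V i)) w).
    rewrite indicE mem_set// big1// => i _.
    by rewrite indicE mem_set//; apply: Vw; rewrite /= inE.
  rewrite [RHS]indicE memNset//.
  have [i nVi] : exists i, ~ V i (X i w).
    by apply: contrapT => /forallNP H; apply: nVw => i _; apply: contrapT; exact: H.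
  by rewrite (bigD1 i)//= indicE memNset// mul0r.
rewrite indepX//; apply: eq_big => [i|i _]; first by rewrite inE.
by rewrite -[in LHS](setIT (_ @^-1` _)) -integral_indic.
Qed.

Lemma expectation_prod (h : I -> R -> R) :
  (forall i, measurable_fun [set: R] (h i)) -> (forall i x, (0 <= h i x)%R) ->
  (forall i, \int[P]_w (h i (X i w))%:E < +oo) ->
  \int[P]_w (\prod_i h i (X i w))%:E = \prod_i \int[P]_w (h i (X i w))%:E.
Proof.
(* Induction on a list of indices outside of which the factors are indicators: by
   the induction hypothesis with [h k] replaced by an arbitrary [\1_V], the law of
   [X k] under the measure of density [\prod_(i != k) h i (X i)] is proportional
   to its law under [P]. *)
have : forall i, i \notin enum I -> exists2 V, measurable V & h i = \1_V.
  by move=> i; rewrite mem_enum.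
elim: (enum I) h => [|k s IHs] h hV mh h0 hfin.
  have /choice[V hV'] : forall i, exists V, measurable V /\ h i = \1_V.
    by move=> i; have [//|V mV hVi] := hV i; exists V.
  under eq_integral do under eq_bigr do rewrite (hV' _).2.
  rewrite expectation_prod_indic; last by move=> i; exact: (hV' i).1.
  by apply: eq_bigr => i _; apply: eq_integral => w _; rewrite (hV' i).2.
have mhX i : measurable_fun [set: T] (fun w => h i (X i w)).
  exact: measurableT_comp.
pose F w := (\prod_(i | i != k) h i (X i w))%R.
have mF : measurable_fun [set: T] F.
  rewrite /F; under eq_fun do rewrite -big_filter.
  exact: measurable_prod.
have F0 w : (0 <= F w)%R by exact: prodr_ge0.
pose c := \prod_(i | i != k) \int[P]_w (h i (X i w))%:E.
(* [ge0_integral_density] takes a real-valued density; finite expectations allow [c] to serve as a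
   constant one. *)
have cfin : c \is a fin_num.
  apply: prode_fin_num => i _; rewrite ge0_fin_numE//.
  by apply: integral_ge0 => w _; rewrite lee_fin.
have FV V : measurable V ->
    \int[P]_(w in X k @^-1` V) (F w)%:E = P (X k @^-1` V) * c.
  move=> mV; pose h' i := if i == k then \1_V else h i.
  have mXV : measurable (X k @^-1` V) by rewrite -[X in measurable X]setTI; exact: mX.
  have intV : \int[P]_w (\1_V (X k w))%:E = P (X k @^-1` V).
    by rewrite -[in RHS](setIT (_ @^-1` _)) -integral_indic.
  transitivity (\int[P]_w (\prod_i h' i (X i w))%:E).
    rewrite integral_mkcond; apply: eq_integral => w _.
    rewrite epatch_indic (bigD1 k)//= /h' eqxx EFinM muleC; congr (_ * _%:E).
    by apply: eq_bigr => i /negbTE ->.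
  rewrite IHs.
  - rewrite (bigD1 k)//= /h' eqxx intV; congr (_ * _).
    by apply: eq_bigr => i /negbTE ->.
  - move=> i si; rewrite /h'; case: eqP => [_|/eqP ik]; first by exists V.
    by apply: hV; rewrite inE negb_or ik.
  - by move=> i; rewrite /h'; case: eqP => // _; exact: measurable_indic.
  - by move=> i x; rewrite /h'; case: eqP.
  - move=> i; rewrite /h'; case: eqP => // ->.
    by rewrite intV (le_lt_trans (probability_le1 _ _)) ?ltry.
pose rho := pushforward P (X k).
pose nu := pushforward (density P mF F0) (X k).
have mhk : measurable_fun [set: R] (fun x => (h k x)%:E) by exact/measurable_EFinP.
have hk0 x : 0 <= (h k x)%:E by rewrite lee_fin.
(* [nu] is the law of [X k] under the measure of density [F]; integrating [h k] against it restores
   the full product. *)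
transitivity (\int[nu]_x (h k x)%:E).
  rewrite ge0_integral_pushforward//.
  rewrite [RHS](ge0_integral_density mF F0 (mu := P))//=; last first.
    exact/measurable_EFinP.
  by apply: eq_integral => w _; rewrite (bigD1 k)//= EFinM.
have fc0 : forall x : R, (0 <= cst (fine c) x)%R.
  move=> x /=; apply: fine_ge0; apply: prode_ge0 => i _.
  by apply: integral_ge0 => w _; rewrite lee_fin.
(* By [FV], [nu] has constant density [c] with respect to [rho], the law of [X k] under [P]. *)
rewrite (ge0_integral_density (measurable_cst _) fc0 (mu := rho))//; last first.
  move=> V mV; rewrite -[RHS]/(\int[rho]_(x in V) cst (fine c)%:E x).
  rewrite integral_cst// fineK//.
  by rewrite muleC; exact: FV.
rewrite ge0_integral_pushforward//=; last first.
  by move=> x _; rewrite mule_ge0// lee_fin fc0.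
  by apply: emeasurable_funM.
rewrite (bigD1 k)//= -/c fineK//.
rewrite preimage_setT ge0_integralZr//.
  exact/measurable_EFinP.
by rewrite -(fineK cfin) lee_fin; exact: (fc0 0%R).
Qed.

End independence.

(** * The Borel sigma-algebra of matrices and its generation by boxes *)

Section borel_matrix.
Context (R : realType) (m n : nat).

Definition box (V : 'I_m -> 'I_n -> set R) : set 'M[R]_(m, n) :=
  [set M | forall i j, V i j (M i j)].

(** The sides are arbitrary measurable sets, as in the definition of independence, so independence
    applies to a box directly. *)
Definition boxes : set (set 'M[R]_(m, n)) :=
  [set box V | V in [set V | forall i j, measurable (V i j)]].

Lemma boxes_setI_closed : setI_closed boxes.
Proof.
move=> _ _ [V mV <-] [W mW <-]; exists (fun i j => V i j `&` W i j).
  by move=> i j; exact: measurableI.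
apply/seteqP; split=> [M VW|M [MV MW] i j]; last by split.
by split=> i j; have [] := VW i j.
Qed.

Lemma boxes_setT : boxes [set: 'M[R]_(m, n)].
Proof. by exists (fun _ _ => setT) => //; apply/seteqP; split. Qed.

Lemma measurable_coord i j :
  measurable_fun [set: borel_matrix R m n] (fun M : borel_matrix R m n => M i j).
Proof.
apply: (measurability _ (RGenOpens.measurableE R)).
move=> _ [_ [a [b ->] <-]]; rewrite setTI; apply: sub_sigma_algebra.
have /continuousP cf := @coord_continuous R m n i j.
by apply: cf; exact: interval_open.
Qed.

Lemma measurable_box V : (forall i j, measurable (V i j)) ->
  measurable (box V : set (borel_matrix R m n)).
Proof.
move=> mV.
rewrite (_ : box V = \bigcap_(i in [set: 'I_m]) \bigcap_(j in [set: 'I_n])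
    ((fun M : borel_matrix R m n => M i j) @^-1` V i j)); last first.
  by apply/seteqP; split=> [M VM i _ j _|M VM i j]; [exact: VM|exact: VM].
apply: fin_bigcap_measurable => // i _; apply: fin_bigcap_measurable => // j _.
by rewrite -[X in measurable X]setTI; exact: measurable_coord.
Qed.

(** Second countability: [U] is the countable union of the cubes contained in it that have rational
    centres and radii [1/(k+1)]. *)
Lemma open_box (U : set 'M[R]_(m, n)) : open U -> <<s boxes >> U.
Proof.
move=> oU.
pose V (qk : 'M[rat]_(m, n) * nat) i j : set R :=
    ball (ratr (qk.1 i j) : R) qk.2.+1%:R^-1.
pose E qk : set (g_sigma_algebraType boxes) :=
  if pselect (box (V qk) `<=` U) then box (V qk) else set0.
have -> : U = \bigcup_qk E qk.
  apply/seteqP; split => [M UM|M [qk _]]; last first.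
    by rewrite /E; case: pselect => // sU /sU.
  have /nbhs_ballP[e /= e0 eU] : nbhs M U by exact: open_nbhs_nbhs.
  (* Two points of a cube of radius below [e / 2] are within [e] of each other, so such a cube
     containing [M] lies in the [e]-ball around [M], hence in [U]. *)
  have [k ke] : exists k, k.+1%:R^-1 < e / 2.
    have /ltr_add_invr[k] : 0 < e / 2 by rewrite divr_gt0.
    by rewrite add0r; exists k.
  have /choice[q qM] : forall ij : 'I_m * 'I_n, exists q : rat,
      ball (ratr q : R) k.+1%:R^-1 (M ij.1 ij.2).
    move=> ij; have /rat_in_itvoo[q] :
        M ij.1 ij.2 - k.+1%:R^-1 < M ij.1 ij.2 + k.+1%:R^-1.
      by rewrite ltrBlDr -addrA ltrDl addr_gt0// invr_gt0.
    rewrite in_itv/= => /andP[q1 q2]; exists q.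
    by rewrite /ball/= ltr_norml ltrBrDr ltrBlDr ![_ + M _ _]addrC q1.
  pose Q : 'M[rat]_(m, n) := \matrix_(i, j) q (i, j).
  have VM : box (V (Q, k)) M by move=> i j; rewrite /V/= mxE; exact: (qM (i, j)).
  exists (Q, k) => //; rewrite /E; case: pselect => // nVU; apply: nVU => N VN.
  apply: eU; split => // i j; have := VN i j; have := VM i j.
  rewrite /V/= => /ball_sym H1 H2; apply: le_ball (ball_triangle H1 H2).
  by rewrite (splitr e) lerD// ltW.
apply: (@countable_bigcupT_measurable _ (g_sigma_algebraType boxes)) => // qk.
rewrite /E; case: pselect => [sU|nU] /=; last exact: measurable0.
apply: sub_sigma_algebra.
by exists (V qk) => // i j; apply: open_measurable; exact: ball_open.
Qed.

(** This makes boxes usable both to test measurability of random matrices and as the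
    intersection-stable family on which measures are compared. *)
Lemma borel_matrixE : @measurable _ (borel_matrix R m n) = <<s boxes >>.
Proof.
apply/seteqP; split.
  by apply: smallest_sub; [exact: smallest_sigma_algebra|exact: open_box].
apply: smallest_sub; first exact: sigma_algebra_measurable.
by move=> _ [V mV <-]; exact: measurable_box.
Qed.

Lemma measurable_fun_matrix d (T : measurableType d) (A : T -> 'M[R]_(m, n)) :
  (forall i j, measurable_fun [set: T] (fun w => A w i j)) ->
  measurable_fun [set: T] (A : T -> borel_matrix R m n).
Proof.
move=> mA; apply: (measurability _ borel_matrixE).
move=> _ [_ [V mV <-] <-].
rewrite (_ : _ @^-1` _ = \bigcap_(i in [set: 'I_m]) \bigcap_(j in [set: 'I_n])
    ((fun w => A w i j) @^-1` V i j)); last first.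
  by apply/seteqP; split=> [M VM i _ j _|M VM i j]; [exact: VM|exact: VM].
rewrite setTI.
apply: fin_bigcap_measurable => // i _; apply: fin_bigcap_measurable => // j _.
by rewrite -[X in measurable X]setTI; exact: mA.
Qed.

End borel_matrix.

Lemma measurable_permanent (R : realType) (n : nat) :
  measurable_fun [set: borel_matrix R n n]
    (fun M : borel_matrix R n n => permanent (M : 'M[R]_n)).
Proof.
apply: measurable_sum => s; apply: measurable_prod => i _.
exact: measurable_coord.
Qed.

(** * Change of measure for Gaussian matrices *)

Section gaussian_matrix.
Context (d : measure_display) (T : measurableType d) (R : realType).
Variables (P : probability T R) (m n : nat) (A : T -> 'M[R]_(m, n)).
Hypothesis hA : std_gaussian_matrix P A.
Implicit Types C : 'M[R]_(m, n).

(** The likelihood ratio [w_C], kept as a product over entries rather than one exponential so that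
    independence factors its expectations. *)
Definition tilt C (M : 'M[R]_(m, n)) : R :=
  \prod_(k : 'I_m * 'I_n) expR (C k.1 k.2 * M k.1 k.2 - C k.1 k.2 ^+ 2 / 2).

Let X (k : 'I_m * 'I_n) w := A w k.1 k.2.

Let mX k : measurable_fun [set: T] (X k).
Proof. by case: hA => mX _ _; exact: mX. Qed.

Let indepX : mutually_independent P X.
Proof. by case: hA. Qed.

Let mA : measurable_fun [set: T] (A : T -> borel_matrix R m n).
Proof. by apply: measurable_fun_matrix => i j; exact: (mX (i, j)). Qed.

Let mAD C : measurable_fun [set: T] (fun w => A w + C : borel_matrix R m n).
Proof.
apply: measurable_fun_matrix => i j; under eq_fun do rewrite mxE.
exact: measurable_funD (mX (i, j)) (measurable_cst _).
Qed.

(** The integral depends on the entry only through its law, which is N(0,1). *)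
Lemma integral_gaussian_entry k (h : R -> R) : measurable_fun [set: R] h ->
  (forall x, 0 <= h x) ->
  (\int[P]_w (h (X k w))%:E = \int[normal_prob 0 1]_x (h x)%:E)%E.
Proof.
move=> mh h0.
have mh' : measurable_fun [set: R] (fun x => (h x)%:E) by exact/measurable_EFinP.
transitivity (\int[pushforward P (X k : T -> measurableTypeR R)]_x (h x)%:E)%E.
  rewrite ge0_integral_pushforward//; first exact: mX.
  by move=> x _; rewrite lee_fin.
apply: eq_measure_integral; [exact: mX|move=> mXk V mV _].
by case: hA => _ PX _; exact: PX.
Qed.

Let measurable_exp_affine (a b : R) :
  measurable_fun [set: R] (fun x => expR (a * x - b)).
Proof. by apply: measurableT_comp => //; exact: measurable_funB. Qed.

(** The Gaussian moment generating function: the integrand is a constant multiple of the tilt by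
    [c], which has total mass 1. *)
Let integral_exp_affine (c b : R) :
  (\int[normal_prob 0 1]_x (expR (c * x - b))%:E = (expR (c ^+ 2 / 2 - b))%:E)%E.
Proof.
transitivity (\int[normal_prob 0 1]_x ((expR (c ^+ 2 / 2 - b))%:E *
    (\1_setT x * expR (c * x - c ^+ 2 / 2))%:E))%E.
  apply: eq_integral => x _; rewrite indicT mul1r -EFinM -expRD.
  by congr (expR _)%:E; ring.
rewrite ge0_integralZl//; last first.
  apply/measurable_EFinP/measurable_funM; first exact: measurable_indic.
  exact: measurable_exp_affine.
by rewrite integral_normal_tilt// preimage_setT probability_setT mule1.
Qed.

Lemma measurable_tilt C :
  measurable_fun [set: T] (fun w => tilt C (A w)).
Proof.
apply: measurable_prod => k _.
exact: (measurableT_comp (measurable_exp_affine _ _) (mX k)).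
Qed.

Lemma tilt_ge0 C M : 0 <= tilt C M.
Proof. by apply: prodr_ge0 => k _; exact: expR_ge0. Qed.

(** Each squared factor is [exp(2 c x - c^2)], with expectation [exp((2 c)^2/2 - c^2) = exp(c^2)];
    the product over entries sums the exponents to the squared norm. *)
Lemma expectation_sqr_tilt C :
  (\int[P]_w (tilt C (A w) ^+ 2)%:E = (expR (hs_norm C ^+ 2))%:E)%E.
Proof.
pose h (k : 'I_m * 'I_n) x := expR ((2 * C k.1 k.2) * x - C k.1 k.2 ^+ 2).
have intE k : (\int[P]_w (h k (X k w))%:E = (expR (C k.1 k.2 ^+ 2))%:E)%E.
  rewrite integral_gaussian_entry//; last first.
  - by move=> x; exact: expR_ge0.
  - exact: measurable_exp_affine.
  by rewrite integral_exp_affine; congr (expR _)%:E; field.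
transitivity (\int[P]_w (\prod_k h k (X k w))%:E)%E.
  apply: eq_integral => w _; rewrite /tilt -prodrXl; congr EFin.
  apply: eq_bigr => k _; rewrite -expRM_natl; congr expR.
  by rewrite /X; field.
rewrite expectation_prod//; last 3 first.
- by move=> k; exact: measurable_exp_affine.
- by move=> k x; exact: expR_ge0.
- by move=> k; rewrite intE ltry.
under eq_bigr do rewrite intE.
rewrite prodEFin -expR_sum /hs_norm sqr_sqrtr; last first.
  by apply: sumr_ge0 => i _; apply: sumr_ge0 => j _; rewrite exprn_ge0.
rewrite pair_bigA/=; congr (expR _)%:E; apply: eq_bigr => k _.
by rewrite real_normK// num_real.
Qed.

Lemma cameron_martin C (S : set (borel_matrix R m n)) : measurable S ->
  P [set w | S (A w + C)] = (\int[P]_(w in A @^-1` S) (tilt C (A w))%:E)%E.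
Proof.
move=> mS.
pose m1 := pushforward P (fun w => A w + C : borel_matrix R m n).
pose m2 := pushforward (density P (measurable_tilt C) (fun w => tilt_ge0 C (A w)))
  (A : T -> borel_matrix R m n).
suff : m1 S = m2 S by [].
(* The constant sequence [setT] serves as the exhausting family: it is a box and has finite mass. *)
apply: (@measure_unique _ R (borel_matrix R m n) (@boxes R m n) (fun=> setT)).
- exact: borel_matrixE.
- exact: boxes_setI_closed.
- by move=> _; exact: boxes_setT.
- by rewrite bigcup_const.
- move=> _ [V mV <-].
  pose W (k : 'I_m * 'I_n) := (fun x : R => x + C k.1 k.2) @^-1` V k.1 k.2.
  have mW k : measurable (W k).
    have mshift : measurable_fun [set: R] (fun x : R => x + C k.1 k.2).
      exact: measurable_funD.
    by rewrite -[X in measurable X]setTI; exact: mshift.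
  pose h (k : 'I_m * 'I_n) x :=
    \1_(V k.1 k.2) x * expR (C k.1 k.2 * x - C k.1 k.2 ^+ 2 / 2).
  have mh k : measurable_fun [set: R] (h k).
    apply: measurable_funM; [exact: measurable_indic|exact: measurable_exp_affine].
  have h0 k x : 0 <= h k x by rewrite mulr_ge0// expR_ge0.
  have intE k : (\int[P]_w (h k (X k w))%:E = normal_prob 0 1 (W k))%E.
    by rewrite integral_gaussian_entry// integral_normal_tilt.
  (* Both masses of the box equal this product: for [m1] by independence of the events [X k] in
     [W k], for [m2] by factoring the expectation and applying the one-dimensional tilt to each
     entry. *)
  transitivity (\prod_(k : 'I_m * 'I_n) normal_prob 0 1 (W k))%E.
    transitivity (P (\bigcap_(k in [set` [set: 'I_m * 'I_n]%SET]) (X k @^-1` W k))).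
      congr (P _); apply/seteqP; split=> w /= VAC.
        by move=> k _; have := VAC k.1 k.2; rewrite mxE.
      by move=> i j; rewrite mxE; apply: (VAC (i, j)); rewrite /= inE.
    rewrite indepX//; apply: eq_big => [k|k _]; first by rewrite inE.
    by case: hA => _ PX _; exact: PX.
  under eq_bigr do rewrite -intE.
  rewrite -expectation_prod//; last first.
    move=> k; rewrite intE.
    by apply: le_lt_trans (probability_le1 (normal_prob 0 1) (mW k)) _; exact: ltry.
  rewrite /m2 /pushforward /density [RHS]integral_mkcond.
  apply: eq_integral => w _.
  rewrite epatch_indic -EFinM; congr EFin; rewrite /h big_split/= mulrC; congr (_ * _).
  have [VA|nVA] := pselect (box V (A w)).
    by rewrite indicE mem_set// big1// => k _; rewrite indicE mem_set//; exact: VA.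
  rewrite [RHS]indicE memNset//.
  have [k nVk] : exists k : 'I_m * 'I_n, ~ V k.1 k.2 (X k w).
    apply: contrapT => /forallNP H; apply: nVA => i j; apply: contrapT.
    exact: (H (i, j)).
  by rewrite (bigD1 k)//= indicE memNset// mul0r.
- by move=> _; change (P setT < +oo)%E; rewrite probability_setT ltry.
- exact: mS.
Qed.

Lemma gaussian_shift_le C (S : set (borel_matrix R m n)) (p : R) : measurable S ->
  (P (A @^-1` S) <= p%:E)%E ->
  (P [set w | S (A w + C)%R] <= (Num.sqrt (expR (hs_norm C ^+ 2) * p))%:E)%E.
Proof.
move=> mS Sp; rewrite cameron_martin//.
have mAS : measurable (A @^-1` S) by rewrite -[X in measurable X]setTI; exact: mA.
have p0 : 0 <= p by rewrite -lee_fin (le_trans _ Sp).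
have mI : measurable_fun [set: T] (\1_(A @^-1` S) : T -> R) by exact: measurable_indic.
have := hoelder P mI (measurable_tilt C) (ltr0n _ 2) (ltr0n _ 2).
rewrite -div1r -splitr => /(_ erefl).
rewrite Lnorm1.
rewrite (_ : (\int[P]_w _)%E = (\int[P]_(w in A @^-1` S) (tilt C (A w))%:E)%E); last first.
  rewrite [RHS]integral_mkcond; apply: eq_integral => w _.
  by rewrite epatch_indic -EFinM/= ger0_norm ?mulr_ge0// ?tilt_ge0// mulrC.
move/le_trans; apply.
rewrite unlock /Lnorm.
have -> : (\int[P]_w (`|(\1_(A @^-1` S) w)%:E| `^ 2) = P (A @^-1` S))%E.
  rewrite -[in RHS](setIT (_ @^-1` _)) -integral_indic//.
  apply: eq_integral => w _ /=; rewrite ger0_norm// -[2%R]/(2%:R) powR_mulrn//.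
  by rewrite indicE; case: (_ \in _); rewrite ?expr1n ?expr0n.
have -> : (\int[P]_w (`|(tilt C (A w))%:E| `^ 2) = (expR (hs_norm C ^+ 2))%:E)%E.
  rewrite -expectation_sqr_tilt; apply: eq_integral => w _ /=.
  by rewrite ger0_norm ?tilt_ge0// -[2%R]/(2%:R) powR_mulrn ?tilt_ge0.
rewrite !poweR12_sqrt//.
rewrite sqrtrM ?expR_ge0// mulrC EFinM.
apply: lee_wpmul2r; first by rewrite lee_fin.
by rewrite -[leRHS]/(sqrte p%:E) lee_sqrt// lee_fin.
Qed.

End gaussian_matrix.

(** * Application to the set where the approximation of the squared permanent fails *)

Theorem lemma16 (R : realType) (d : measure_display) (T : measurableType d)
    (P : probability T R) (n : nat) (A : T -> 'M[R]_n)
    (hA : std_gaussian_matrix P A)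
    (eps delta : R) (heps : 0 <= eps) (hdelta : 0 <= delta <= 1)
    (g : 'M[R]_n -> R)
    (mg : measurable_fun [set: borel_matrix R n n] (g : borel_matrix R n n -> R))
    (hg : ((1 - delta)%:E <=
      P [set w | (`| `|permanent (A w)| ^+ 2 - g (A w)| <= eps)%R])%E)
    (B : 'M[R]_n) (hB : forall i j, `|B i j| <= 1) (t : R) :
  ((1 - Num.sqrt (expR (hs_norm (t *: B) ^+ 2) * delta))%:E <=
    P [set w | (`| `|permanent (A w + t *: B)| ^+ 2 - g (A w + t *: B)|
                 <= eps)%R])%E.
Proof.
pose f (M : borel_matrix R n n) := `| `|permanent (M : 'M[R]_n)| ^+ 2 - g M|.
have mf : measurable_fun [set: borel_matrix R n n] f.
  apply: measurableT_comp => //; apply: measurable_funB => //.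
  apply: measurable_funX; apply: measurableT_comp => //.
  exact: measurable_permanent.
(* The open half-line encodes strict failure, so that the complement of [S] is exactly the good
   event. *)
pose S : set (borel_matrix R n n) := f @^-1` [set` `]eps, +oo[].
have mS : measurable S.
  by rewrite -[S]setTI; apply: mf => //; exact: measurable_itv.
have goodE (h : T -> 'M[R]_n) : [set w | f (h w) <= eps] = ~` (h @^-1` S).
  apply/seteqP; split=> w /=; rewrite /S/= in_itv/= andbT.
    by move=> fe; rewrite ltNge fe.
  by move=> /negP; rewrite -leNgt.
have mh (C : 'M[R]_n) : measurable ((fun w => A w + C) @^-1` S).
  have mAC : measurable_fun [set: T] (fun w => A w + C : borel_matrix R n n).
    apply: measurable_fun_matrix => i j; under eq_fun do rewrite mxE.
    by apply: measurable_funD => //; case: hA.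
  by rewrite -[X in measurable X]setTI; exact: mAC.
have mA : measurable (A @^-1` S).
  by have := mh 0; under eq_fun do rewrite addr0.
(* The lower bound on the good event becomes an upper bound on its complement; [fineK] passes to
   real numbers, where the 1 cancels. *)
have bad_le : (P (A @^-1` S) <= delta%:E)%E.
  move: hg; rewrite -/(f _) (goodE A) probability_setC//.
  rewrite -(fineK (fin_num_measure P _ mA)) -EFinB !lee_fin.
  by rewrite lerD2l lerN2.
have := gaussian_shift_le hA (t *: B) mS bad_le.
rewrite (goodE (fun w => A w + t *: B)) probability_setC//.
rewrite -[P [set w | _]]/(P ((fun w => A w + t *: B)%R @^-1` S)).
rewrite -(fineK (fin_num_measure P _ (mh (t *: B)))) -EFinB !lee_fin.
by rewrite lerD2l lerN2.
Qed.
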